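(* Let $P$ be a poset on the ground set $\{x_1,\ldots,x_n\}$, let $k$ be a field, $S=k[x_1,\ldots,x_n]$, and let $t\geq 2$ be an integer. Then $$\operatorname{reg}(S/I_t(P))\geq a_t(P)\cdot (t-1).$$
   Context: The elements of $P$ are identified with the variables of $S$; $k$ is an arbitrary field. A path of length $t$ in $P$ is a saturated chain of $t$ elements, i.e. a sequence $x_{i_1},\ldots,x_{i_t}$ in which $x_{i_{j+1}}$ covers $x_{i_j}$ for $1\le j\le t-1$ (length counts vertices). The path ideal is $I_t(P)=\langle x_{i_1}\cdots x_{i_t} : x_{i_1},\ldots,x_{i_t}\text{ is a path of length } t \text{ in } P\rangle\subseteq S$. The integer $a_t(P)$ is the maximal integer $s$ such that there exists a set $\{P_1,\ldots,P_s\}$ of pairwise disjoint paths of length $t$ in $P$ such that $\bigcup_{i=1}^s P_i$ (as a set of elements) contains no paths of length $t$ in $P$ other than $P_1,\dots,P_s$. $\operatorname{reg}$ denotes Castelnuovo–Mumford regularity. *)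

(* Defs.v *)
From HB Require Import structures.
From mathcomp Require Import all_boot all_order all_algebra.
From mathcomp Require Import mpoly.

Set Implicit Arguments.
Unset Strict Implicit.
Unset Printing Implicit Defensive.

Import Order.TTheory GRing.Theory Num.Theory.
Local Open Scope ring_scope.

Section Paths.

(* A poset on the ground set {x_1, ..., x_n} is an order relation on 'I_n; an
   explicit relation is used because 'I_n already carries its usual order. *)
Variables (n : nat) (le : rel 'I_n).

Definition covers (x y : 'I_n) : bool :=
  [&& x != y, le x y
    & [forall z, le x z && le z y ==> (z == x) || (z == y)]].

Definition is_path (t : nat) (p : t.-tuple 'I_n) : bool := sorted covers p.

(* A path is an increasing sequence, so distinct tuples that are paths have
   distinct underlying sets: a set of tuples is a set of paths. *)
Definition induced_path_family (t : nat) (A : {set t.-tuple 'I_n}) : bool :=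
  [&& [forall p in A, is_path p],
      [forall p in A, forall q in A,
         (p != q) ==> [forall v, ~~ ((v \in p) && (v \in q))]]
    & [forall p : t.-tuple 'I_n,
         is_path p && [forall v in p, exists q in A, v \in q] ==> (p \in A)]].

(* The empty family is admissible for t > 0, so this maximum is attained. *)
Definition path_packing_number (t : nat) : nat :=
  \max_(A : {set t.-tuple 'I_n} | induced_path_family A) #|A|.

Definition path_monomial (k : fieldType) (t : nat) (p : t.-tuple 'I_n) :
  {mpoly k[n]} := \prod_(v <- p) 'X_v.

Definition path_ideal (k : fieldType) (t : nat) (f : {mpoly k[n]}) : Prop :=
  exists c : t.-tuple 'I_n -> {mpoly k[n]},
    f = \sum_(p : t.-tuple 'I_n | is_path p) c p * path_monomial k p.

End Paths.

Section Regularity.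

Variables (k : fieldType) (n : nat).
Local Notation S := {mpoly k[n]}.

(* Degrees of generators of graded modules are integers; only 0 is homogeneous
   of negative degree in S. *)
Definition homog_in_degree (d : int) (f : S) : bool :=
  match d with
  | Posz e => f \is e.-homog
  | Negz _ => f == 0
  end.

(* A minimal graded free resolution
     ... -> F_2 -> F_1 -> F_0 -> S/I -> 0
   of S/I for a homogeneous ideal I, with F_i the direct sum over b of the
   S(- mres_deg i b), i.e. F_i has a basis whose element b has degree
   mres_deg i b.  Elements of F_i are row vectors and the differential
   F_{i+1} -> F_i is v |-> v *m mres_diff i.  The augmentation F_0 -> S/I is
   v |-> class of (v *m mres_aug) 0 0: it is given by homogeneous
   representatives in S of the images of the basis elements. *)
Record minimal_resolution (I : S -> Prop) := MinimalResolution {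
  mres_rank : nat -> nat;
  mres_deg : forall i, 'I_(mres_rank i) -> int;
  mres_diff : forall i, 'M[S]_(mres_rank i.+1, mres_rank i);
  mres_aug : 'cV[S]_(mres_rank 0);
  mres_diff_homog : forall i a b,
    homog_in_degree (mres_deg a - mres_deg b) (mres_diff i a b);
  mres_aug_homog : forall b, homog_in_degree (mres_deg b) (mres_aug b 0);
  mres_aug_surj : forall f : S, exists v : 'rV[S]_(mres_rank 0),
    I ((v *m mres_aug) 0 0 - f);
  mres_exact0 : forall v : 'rV[S]_(mres_rank 0),
    I ((v *m mres_aug) 0 0) <->
    exists w : 'rV[S]_(mres_rank 1), v = w *m mres_diff 0;
  mres_exact : forall i (v : 'rV[S]_(mres_rank i.+1)),
    v *m mres_diff i = 0 <->
    exists w : 'rV[S]_(mres_rank i.+2), v = w *m mres_diff i.+1;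
  (* d(F_{i+1}) is contained in (x_1, ..., x_n) F_i *)
  mres_minimal : forall i a b, (mres_diff i a b)@_0%MM = 0
}.

Definition betti (I : S -> Prop) (F : minimal_resolution I) (i : nat) (j : int)
  : nat := #|[set b : 'I_(mres_rank F i) | mres_deg b == j]|.

(* reg(S/I) = r, where reg(S/I) = max {j - i | beta_{i,j}(S/I) <> 0}.  A
   relation rather than a function: the minimal graded free resolution is only
   unique up to isomorphism. *)
Definition regularity (I : S -> Prop) (r : int) : Prop :=
  exists F : minimal_resolution I,
    (exists (i : nat) (j : int), betti F i j <> 0%N /\ r = j - i%:Z) /\
    (forall (i : nat) (j : int), betti F i j <> 0%N -> j - i%:Z <= r).

End Regularity.

(* Main.v *)
(* Let P_1, ..., P_s be an induced family of disjoint paths, f_1, ..., f_s their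
   monomials and K the Koszul complex of the f_j.  It suffices to find a basis
   element of degree st in step s of the minimal resolution F of S/I_t(P), for
   then reg >= st - s.  Since F is exact and the f_j lie in I_t(P), there is a
   homogeneous chain map phi : K -> F over S -> S/I_t(P).  Setting the variables
   outside the union of the P_j to 0 maps I_t(P) into (f_1, ..., f_s), because
   the family is induced, and fixes the f_j.  The f_j are monomials with disjoint
   supports, so K is exact and there is a chain map psi back to K from the
   complex obtained from F by this substitution.  The composite of phi and psi
   is homotopic to the identity and K is minimal, so phi_s has an entry with a
   nonzero constant term; as K_s is generated in degree st, homogeneity of phi_s
   yields the required basis element. *)
From HB Require Import structures.
Require Import Defs.
From mathcomp Require Import all_boot all_order all_algebra.
From mathcomp Require Import mpoly.

Set Implicit Arguments.
Unset Strict Implicit.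
Unset Printing Implicit Defensive.

Import Order.TTheory GRing.Theory Num.Theory.
Local Open Scope ring_scope.

(** Exactness is stated for single row vectors; choosing preimages row by row extends it to
    matrices. *)
Lemma row_lift (R : pzSemiRingType) p q m (A : 'M[R]_(p, q)) (B : 'M_(m, q)) :
  (forall i, exists w, row i A = w *m B) -> exists C, A = C *m B.
Proof.
move=> /fin_all_exists[w Aw]; exists (\matrix_i w i).
by apply/row_matrixP=> i; rewrite row_mul rowK.
Qed.

(** * The Koszul complex *)

(* The ranks of the iterated mapping cone: C(m, i), but with Pascal's rule and
   the value 1 at i = 0 holding by conversion, so that the block matrices below
   need no casts. *)
Fixpoint koszul_rank_succ (m i : nat) : nat :=
  if m is m'.+1 then
    (koszul_rank_succ m' i + if i is i'.+1 then koszul_rank_succ m' i' else 1)%N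
  else 0%N.

Definition koszul_rank (m i : nat) : nat :=
  if i is i'.+1 then koszul_rank_succ m i' else 1%N.

Lemma koszul_rank_top m : (0 < koszul_rank m m)%N.
Proof. by elim: m => [|m] //=; rewrite addn_gt0 => ->; rewrite orbT. Qed.

(** Mapping cone of multiplication by [f m']: basis elements without the last exterior generator
    come first, those with it second. The minus sign makes the square vanish. *)
Fixpoint koszul (R : pzRingType) (f : nat -> R) (m : nat) :
    forall i, 'M[R]_(koszul_rank m i.+1, koszul_rank m i) :=
  match m with
  | 0 => fun=> 0
  | m'.+1 => fun i => match i with
    | 0 => col_mx (koszul f m' 0) (f m')%:M
    | i'.+1 => block_mx (koszul f m' i'.+1) 0 (f m')%:M (- koszul f m' i')
    end
  end.

(** Every entry is 0 or some [f j] up to sign, so degrees, constant terms and ideal membership need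
    checking only on the [f j]. *)
Lemma koszul_entry (R : pzRingType) (f : nat -> R) (P : R -> Prop) m :
    P 0 -> (forall x, P x -> P (- x)) -> (forall j, (j < m)%N -> P (f j)) ->
  forall i a b, P (koszul f m i a b).
Proof.
move=> P0 PN; elim: m => [|m IHm] Pf; first by move=> i; case.
have {}IHm := IHm (fun j lt_jm => Pf j (ltnW lt_jm)).
have Pfm : P (f m) by apply: Pf.
have Pscal (c : bool) : P (f m *+ c) by case: c; rewrite ?mulr1n ?mulr0n.
case=> [|i] a b; rewrite mxE; case: (split a) => c.
- exact: IHm.
- by rewrite mxE.
- by rewrite mxE; case: (split b) => d; rewrite ?mxE.
- by rewrite mxE; case: (split b) => d; rewrite !mxE //; apply: PN.
Qed.

Lemma map_koszul (R R' : pzRingType) (g : {rmorphism R -> R'}) (f : nat -> R)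
    (f' : nat -> R') m i :
    (forall j, (j < m)%N -> g (f j) = f' j) ->
  map_mx g (koszul f m i) = koszul f' m i.
Proof.
elim: m i => [|m IHm] i gf; first exact: map_mx0.
have {}IHm i0 := IHm i0 (fun j lt_jm => gf j (ltnW lt_jm)).
case: i => [|i] /=; first by rewrite map_col_mx map_scalar_mx IHm gf.
by rewrite map_block_mx map_scalar_mx map_mxN !IHm map_mx0 gf.
Qed.

Lemma koszul_complex (R : comPzRingType) (f : nat -> R) m i :
  koszul f m i.+1 *m koszul f m i = 0.
Proof.
elim: m i => [|m IHm] i; first exact: mulmx0.
case: i => [|i] /=.
  rewrite mul_block_col IHm mul0mx addr0 mul_scalar_mx mul_mx_scalar scalerN.
  by rewrite subrr col_mx0.
rewrite mulmx_block !mulNmx !mulmxN opprK !IHm !mul0mx !mulmx0 mul_scalar_mx.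
by rewrite mul_mx_scalar !subrr !addr0 block_mx0.
Qed.

(** A weakly regular sequence; the ideal of the elements before [f j] appears as the image of the
    first differential. *)
Definition koszul_regular (R : comPzRingType) (f : nat -> R) m :=
  forall j (b : 'rV_1), (j < m)%N ->
    (exists w, f j *: b = w *m koszul f j 0) ->
    exists w, b = w *m koszul f j 0.

(** Induction along the cone: in a cycle [(a, b)], the part [b] bounds in the smaller complex, by
    induction or, in the lowest degree, by regularity of [f m]. *)
Lemma koszul_exact (R : comPzRingType) (f : nat -> R) m :
    koszul_regular f m ->
  forall i (v : 'rV_(koszul_rank m i.+1)),
    v *m koszul f m i = 0 -> exists w, v = w *m koszul f m i.+1.
Proof.
elim: m => [|m IHm] reg_f i v.
  by move=> _; exists 0; apply/rowP=> -[].
have {}IHm := IHm (fun j b lt_jm => reg_f j b (ltnW lt_jm)).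
(* Given [b'] with boundary [b], the vector [a + f m *: b'] is a cycle of the smaller complex, so it
   is the boundary of some [c]; then [(c, - b')] bounds [(a, b)]. *)
have lift i0 (a : 'rV_(koszul_rank m i0.+1)) b b' :
    b = b' *m koszul f m i0 ->
    a *m koszul f m i0 + f m *: b = 0 ->
    exists w, row_mx a b = w *m block_mx (koszul f m i0.+1) 0
                                         (f m)%:M (- koszul f m i0).
  move=> -> abd0.
  have [c Dc] : exists w, a + f m *: b' = w *m koszul f m i0.+1.
    by apply: IHm; rewrite mulmxDl -scalemxAl.
  exists (row_mx c (- b')); rewrite mul_row_block mulmx0 add0r -Dc.
  by rewrite !mulNmx mulmxN opprK mul_mx_scalar addrK.
case: i v => [|i] v /=; rewrite -[v]hsubmxK.
  rewrite mul_row_col mul_mx_scalar => vd0.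
  have [|b' Db] := reg_f m (rsubmx v) (ltnSn m); last exact: (lift 0%N _ _ b').
  exists (- lsubmx v); rewrite mulNmx; apply/eqP.
  by rewrite -addr_eq0 addrC vd0.
rewrite mul_row_block mul_mx_scalar mulmx0 add0r mulmxN => /eqP.
rewrite row_mx_eq0 oppr_eq0 => /andP[/eqP vd0 /eqP /IHm[b' Db]].
exact: (lift i.+1 _ _ b').
Qed.

Lemma koszul_image (R : comPzRingType) (f : nat -> R) m (b : 'rV_1) :
  (exists w, b = w *m koszul f m 0) <->
  exists c : nat -> R, b 0 0 = \sum_(j < m) c j * f j.
Proof.
elim: m b => [|m IHm] b.
  split=> [[w ->]|[c]]; first by exists (fun=> 0); rewrite big_ord0 mulmx0 mxE.
  rewrite big_ord0 => b0; exists 0; rewrite mulmx0.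
  by apply/rowP=> i; rewrite ord1 b0 mxE.
split=> [[w]|[c Dc]].
  rewrite /= -[w]hsubmxK mul_row_col mul_mx_scalar => Db.
  have [c Dc] : exists c : nat -> R,
      (lsubmx w *m koszul f m 0) 0 0 = \sum_(j < m) c j * f j.
    by apply/IHm; exists (lsubmx w).
  exists (fun j => if (j < m)%N then c j else rsubmx w 0 0).
  rewrite big_ord_recr /= ltnn Db mxE Dc [in LHS]mxE [f m * _]mulrC.
  by congr (_ + _); apply: eq_bigr => j _; rewrite ltn_ord.
have [|w Dw] := (IHm (b - (c m * f m)%:M)).2.
  by exists c; rewrite !mxE Dc big_ord_recr eqxx mulr1n addrK.
exists (row_mx w (c m)%:M); rewrite /= mul_row_col -Dw -scalar_mxM.
by rewrite subrK.
Qed.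

(** * Homogeneous matrices *)

Section Homogeneous.

Variables (k : fieldType) (n : nat).
Local Notation S := {mpoly k[n]}.
Implicit Types (z y : int) (f g : S).

Lemma homog_in_degree0 z : homog_in_degree z (0 : S).
Proof. by case: z => [d|d] /=; rewrite ?rpred0. Qed.

Lemma homog_in_degreeD z f g :
  homog_in_degree z f -> homog_in_degree z g -> homog_in_degree z (f + g).
Proof.
case: z => [d|d] /=; first exact: rpredD.
by move=> /eqP-> /eqP->; rewrite addr0.
Qed.

Lemma homog_in_degreeN z f : homog_in_degree z f -> homog_in_degree z (- f).
Proof. by case: z => [d|d] /=; rewrite ?rpredN ?oppr_eq0. Qed.

Lemma homog_in_degreeM z y f g :
  homog_in_degree z f -> homog_in_degree y g -> homog_in_degree (z + y) (f * g).
Proof.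
case: z y => [d|d] [e|e] /=.
- exact: dhomogM.
- by move=> _ /eqP->; rewrite mulr0 homog_in_degree0.
- by move=> /eqP-> _; rewrite mul0r homog_in_degree0.
- by move=> /eqP->; rewrite mul0r.
Qed.

Lemma homog_in_degree_coeff0 z f : homog_in_degree z f -> f@_0%MM != 0 -> z = 0.
Proof.
case: z => [d|d] /=; last by move=> /eqP->; rewrite mcoeff0 eqxx.
move=> fd; apply: contraNeq; rewrite eqz_nat eq_sym => d_neq0.
by rewrite (dhomog_nemf_coeff fd) // mf0.
Qed.

Definition homog_part z f : S :=
  if z is Posz d then pihomog mdeg d f else 0.

Lemma homog_part_is_additive z : zmod_morphism (homog_part z).
Proof. by case: z => d f g; rewrite /homog_part ?pihomogB ?subrr. Qed.

HB.instance Definition _ z :=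
  GRing.isZmodMorphism.Build S S (homog_part z) (homog_part_is_additive z).

Lemma homog_partP z f : homog_in_degree z (homog_part z f).
Proof. by case: z => [d|d] //=; apply: pihomogP. Qed.

Lemma homog_part_homog z y f :
  homog_in_degree y f -> homog_part z f = if z == y then f else 0.
Proof.
case: y => [e|e] /=; last by move/eqP->; rewrite raddf0 if_same.
case: z => [d|d] //= fe; rewrite eqz_nat; have [->|/eqP de] := eqVneq.
  exact: pihomog_dE.
by apply: (@pihomog_ne0 _ _ _ e) => //; rewrite eq_sym; apply/eqP.
Qed.

Lemma homog_partM z y f g : homog_in_degree y g ->
  homog_part (z + y) (f * g) = homog_part z f * g.
Proof.
move=> gy; rewrite [f](pihomog_partitionE (mf := mdeg) (leqnn _)).
rewrite mulr_suml !raddf_sum mulr_suml; apply: eq_bigr => d _ /=.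
have fd : homog_in_degree d%:Z (pihomog mdeg d f) by apply: pihomogP.
rewrite (homog_part_homog _ fd) (homog_part_homog _ (homog_in_degreeM fd gy)).
by rewrite (inj_eq (addIr _)); case: eqP; rewrite ?mul0r.
Qed.

(** Degree-preserving maps, on row vectors, from the sum of the S(- d a) to the sum of the S(- e
    b). *)
Definition homog_mx p q (d : 'I_p -> int) (e : 'I_q -> int) (A : 'M[S]_(p, q)) :=
  forall a b, homog_in_degree (d a - e b) (A a b).

Lemma homog_mxM p q r (d : 'I_p -> int) (e : 'I_q -> int) (c : 'I_r -> int) A B :
  homog_mx d e A -> homog_mx e c B -> homog_mx d c (A *m B).
Proof.
move=> hA hB a b; rewrite mxE; apply: (big_ind (homog_in_degree _)).
- exact: homog_in_degree0.
- by move=> x y; apply: homog_in_degreeD.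
- by move=> j _; rewrite -(subrKA (e j)); apply: homog_in_degreeM.
Qed.

(** Multiplying by a homogeneous [D] commutes with taking homogeneous parts of matching degrees;
    this makes lifts obtained from exactness homogeneous. *)
Lemma homog_part_mulmx p q r (d : 'I_p -> int) (e : 'I_q -> int)
    (c : 'I_r -> int) (W : 'M_(p, q)) (D : 'M_(q, r)) : homog_mx e c D ->
  exists2 W', homog_mx d e W' &
    forall a b, (W' *m D) a b = homog_part (d a - c b) ((W *m D) a b).
Proof.
move=> hD; exists (\matrix_(a, j) homog_part (d a - e j) (W a j)).
  by move=> a b; rewrite mxE; apply: homog_partP.
move=> a b; rewrite !mxE raddf_sum; apply: eq_bigr => j _.
by rewrite mxE -(homog_partM _ _ (hD j b)) subrKA.
Qed.

Lemma homog_lift p q r (d : 'I_p -> int) (e : 'I_q -> int) (c : 'I_r -> int)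
    (V : 'M_(p, r)) (W : 'M_(p, q)) (D : 'M_(q, r)) :
    homog_mx e c D -> homog_mx d c V -> V = W *m D ->
  exists2 W', homog_mx d e W' & V = W' *m D.
Proof.
move=> hD hV VWD; have [W' hW' W'D] := homog_part_mulmx d W hD.
exists W' => //; apply/matrixP=> a b.
by rewrite W'D -VWD (homog_part_homog _ (hV a b)) eqxx.
Qed.

End Homogeneous.

(** * Monomial regular sequences *)

Lemma mem_monomial_ideal (k : fieldType) n (M : nat -> 'X_{1..n}) m
    (g : {mpoly k[n]}) :
  (exists c : nat -> {mpoly k[n]}, g = \sum_(j < m) c j * 'X_[M j]) <->
  {in msupp g, forall u, exists2 j, (j < m)%N & (M j <= u)%MM}.
Proof.
split=> [[c ->] u|supp_g].
  rewrite mcoeff_msupp raddf_sum => u_in.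
  have [j cu] : exists j : 'I_m, (c j * 'X_[M j])@_u != 0.
    apply/existsP; apply: contraNT u_in; rewrite negb_exists => /forallP c0.
    by rewrite big1 // => j _; apply/eqP; rewrite -[_ == _]negbK c0.
  exists j => //; move: cu; rewrite -mcoeff_msupp.
  by rewrite (perm_mem (msuppMX _ _)) => /mapP[u' _ ->]; apply: lem_addr.
rewrite [g]mpolyE big_seq.
apply: (big_ind
  (fun h => exists c : nat -> _, h = \sum_(j < m) c j * 'X_[M j])).
- by exists (fun=> 0); rewrite big1 // => j _; rewrite mul0r.
- move=> _ _ [c ->] [c' ->]; exists (fun j => c j + c' j).
  by rewrite -big_split; apply: eq_bigr => j _; rewrite mulrDl.
move=> u /supp_g[j lt_jm le_ju].
exists (fun i => if i == j then g@_u *: 'X_[u - M j] else 0).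
rewrite (bigD1 (Ordinal lt_jm)) //= eqxx big1 ?addr0 => [|i].
  by rewrite -scalerAl -mpolyXD submK.
by rewrite -val_eqE /= => /negPf->; rewrite mul0r.
Qed.

(** If the monomial of [M i] divides that of [M j + u] and shares no variable with that of [M j], it
    already divides that of [u]. *)
Lemma monomial_regular (k : fieldType) n (M : nat -> 'X_{1..n}) m :
    (forall i j v, (i < j < m)%N -> (M i v == 0%N) || (M j v == 0%N)) ->
  koszul_regular (fun j => 'X_[M j] : {mpoly k[n]}) m.
Proof.
move=> disjM j b lt_jm /koszul_image/mem_monomial_ideal supp_fb.
apply/koszul_image/mem_monomial_ideal => u u_b.
have [|i lt_ij le_i] := supp_fb (M j + u)%MM.
  by rewrite mxE mulrC (perm_mem (msuppMX _ _)) map_f.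
exists i => //; apply/mnm_lepP => v; move/mnm_lepP/(_ v): le_i.
rewrite mnmDE; have := disjM i j v; rewrite lt_ij lt_jm.
by case/(_ isT)/orP => /eqP->.
Qed.

(** * Comparison of a resolution with the Koszul complex *)

Section Comparison.

Variables (k : fieldType) (n : nat).
Local Notation S := {mpoly k[n]}.
Variables (I : S -> Prop) (F : minimal_resolution I).
Variables (f : nat -> S) (m t : nat) (p : {rmorphism S -> S}).

Hypotheses (I0 : I 0) (ID : forall g h, I g -> I h -> I (g + h)).
Hypothesis IM : forall g h, I h -> I (g * h).
Hypothesis I_homog : forall z g, I g -> I (homog_part z g).
Hypotheses (t_gt0 : (0 < t)%N) (f_homog : forall j, (j < m)%N -> f j \is t.-homog).
Hypothesis f_I : forall j, (j < m)%N -> I (f j).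
Hypothesis f_reg : koszul_regular f m.
(** [p] stands for the substitution killing the variables outside the chosen paths; [p_I] is where
    inducedness of the family will enter. *)
Hypothesis p_f : forall j, (j < m)%N -> p (f j) = f j.
Hypothesis p_I :
  forall g, I g -> exists c : nat -> S, p g = \sum_(j < m) c j * f j.
Hypothesis p_coeff0 : forall g, (p g)@_0%MM = g@_0%MM.

Local Notation K := (koszul f m).
Local Notation d := (mres_diff F).
Local Notation eps := (map_mx (@mcoeff n k 0%MM)).
Local Notation degK i := (fun=> (i * t)%:Z).

Lemma koszul_homog i : homog_mx (degK i.+1) (degK i) (K i).
Proof.
move=> a b; have -> : (i.+1 * t)%:Z - (i * t)%:Z = t%:Z.
  by rewrite mulSn PoszD addrK.
apply: (koszul_entry (P := fun g => homog_in_degree t%:Z g)) => //.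
  exact: homog_in_degree0.
by move=> g; apply: homog_in_degreeN.
Qed.

Lemma koszul_coeff0 i : eps (K i) = 0.
Proof.
apply/matrixP=> a b; rewrite !mxE.
apply: (koszul_entry (P := fun g => g@_0%MM = 0)) => [|g g0|j lt_jm].
- exact: mcoeff0.
- by rewrite mcoeffN g0 oppr0.
by rewrite (dhomog_nemf_coeff (f_homog lt_jm)) // mf0 eq_sym -lt0n.
Qed.

Lemma eps_p a b (A : 'M[S]_(a, b)) : eps (map_mx p A) = eps A.
Proof. by apply/matrixP=> i j; rewrite !mxE p_coeff0. Qed.

Lemma koszul_lift q i (V : 'M[S]_(q, koszul_rank m i.+1)) :
  V *m K i = 0 -> exists W, V = W *m K i.+1.
Proof.
move=> VK0; apply: row_lift => a; apply: (koszul_exact f_reg).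
by rewrite -row_mul VK0 row0.
Qed.

Lemma resolution_lift q i (V : 'M[S]_(q, mres_rank F i.+1)) :
  V *m d i = 0 -> exists W, V = W *m d i.+1.
Proof.
move=> Vd0; apply: row_lift => a; apply/mres_exact.
by rewrite -row_mul Vd0 row0.
Qed.

Lemma resolution_complex i : d i.+1 *m d i = 0.
Proof.
apply/row_matrixP=> a; rewrite row_mul row0; apply/mres_exact.
by exists (delta_mx 0 a); rewrite -rowE.
Qed.

(** Starts the chain map to [F]: the degree 0 part of any lift of 1 still lifts 1, because [I] is
    homogeneous. *)
Lemma unit_lift : exists2 v : 'M[S]_(1, mres_rank F 0),
  homog_mx (degK 0) (@mres_deg _ _ _ F 0) v & I ((v *m mres_aug F) 0 0 - 1).
Proof.
have [v v1] := mres_aug_surj F 1.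
have haug : homog_mx (@mres_deg _ _ _ F 0) (degK 0) (mres_aug F).
  by move=> a b; rewrite [b]ord1 subr0; apply: mres_aug_homog.
have [w hw waug] := homog_part_mulmx (degK 0) v haug.
exists w => //; rewrite waug subrr.
have h1 : homog_in_degree 0 (1 : S) by apply: dhomog1.
have := I_homog 0 v1.
by rewrite raddfB /= (pihomog_dE h1).
Qed.

(* [phi] and [psi] are the components in degree i of chain maps from the Koszul
   complex over S to F and from F, base changed along p, back to the Koszul
   complex; h is the component of a homotopy from the identity to their
   composite.  The conditions with [K i] or [d i] on the left say that each of
   them can be continued in degree i + 1. *)
Lemma comparison_step i :
  exists (phi : 'M[S]_(koszul_rank m i, mres_rank F i)) (phi' : 'M_(_, _))
    (psi : 'M_(mres_rank F i, koszul_rank m i)) (psi' : 'M_(_, _))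
    (h : 'M_(koszul_rank m i, koszul_rank m i.+1)),
  [/\ homog_mx (degK i) (@mres_deg _ _ _ F i) phi,
      eps phi *m eps psi = 1%:M,
      K i *m phi = phi' *m d i,
      map_mx p (d i) *m psi = psi' *m K i &
      K i *m (map_mx p phi *m psi - 1%:M - h *m K i) = 0].
Proof.
elim: i => [|i [phi [phi' [psi [psi' [h [hphi _ Dphi Dpsi Dh]]]]]]].
  have [phi hphi phi1] := unit_lift.
  have [phi' Dphi] : exists phi', K 0 *m phi = phi' *m d 0.
    apply: row_lift => a; apply/mres_exact0.
    have -> : row a (K 0 *m phi) = K 0 a 0 *: phi.
      by apply/rowP=> b; rewrite !mxE big_ord1.
    rewrite -scalemxAl mxE -[_ *m _ in X in I X](subrK 1%:M) mxE mulrDr.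
    have Ka : I (K 0 a 0).
      apply: (koszul_entry (P := I)) => // g Ig.
      by rewrite -mulN1r; apply: IM.
    apply: ID; first by rewrite mulrC; apply: IM.
    by rewrite mxE mulr1.
  (* In degree 0, [psi] is the augmentation followed by [p]: boundaries go into [I], hence into the
     ideal of the [f j], the image of [K 0]. *)
  have [psi' Dpsi] :
      exists psi', map_mx p (d 0) *m map_mx p (mres_aug F) = psi' *m K 0.
    apply: row_lift => a; apply/koszul_image.
    rewrite -map_mxM -map_row mxE; apply: p_I; rewrite row_mul.
    by apply/mres_exact0; exists (delta_mx 0 a); rewrite -rowE.
  have [h Dh] :
      exists h, map_mx p phi *m map_mx p (mres_aug F) - 1%:M = h *m K 0.
    apply/koszul_image; have := p_I phi1; rewrite rmorphB rmorph1.
    suff -> : (map_mx p phi *m map_mx p (mres_aug F) - 1%:M) 0 0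
              = p ((phi *m mres_aug F) 0 0) - 1 by [].
    by rewrite -map_mxM !mxE.
  exists phi, phi', (map_mx p (mres_aug F)), psi', h; split=> //.
    (* The composite differs from the identity by [h *m K 0], whose entries have no constant
       term. *)
    rewrite -[eps phi]eps_p -map_mxM -[_ *m _](subrK 1%:M) Dh map_mxD map_mxM.
    by rewrite koszul_coeff0 mulmx0 add0r map_scalar_mx rmorph1.
  by rewrite Dh subrr mulmx0.
(* The lift [phi'] is replaced by a homogeneous one, as degrees will be read off from it. *)
have [phi1 hphi1 Dphi1] : exists2 phi1,
    homog_mx (degK i.+1) (@mres_deg _ _ _ F i.+1) phi1 &
    K i *m phi = phi1 *m d i.
  apply: homog_lift Dphi; last exact: homog_mxM (@koszul_homog i) hphi.
  exact: mres_diff_homog.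
have [phi2 Dphi2] : exists phi2, K i.+1 *m phi1 = phi2 *m d i.+1.
  apply: resolution_lift.
  by rewrite -mulmxA -Dphi1 mulmxA koszul_complex mul0mx.
have [psi2 Dpsi2] : exists psi2, map_mx p (d i.+1) *m psi' = psi2 *m K i.+1.
  apply: koszul_lift; rewrite -mulmxA -Dpsi mulmxA -map_mxM resolution_complex.
  by rewrite map_mx0 mul0mx.
have pK : map_mx p (K i) = K i by apply: map_koszul.
(* By [Dh] the left side is a cycle, so exactness of the Koszul complex continues the homotopy. *)
have [h1 Dh1] :
    exists h1, map_mx p phi1 *m psi' - 1%:M - K i *m h = h1 *m K i.+1.
  apply: koszul_lift; rewrite !mulmxBl mul1mx -!mulmxA -Dpsi.
  rewrite [map_mx p phi1 *m _]mulmxA -map_mxM -Dphi1 map_mxM pK.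
  by rewrite -Dh !mulmxBr mulmx1 !mulmxA.
exists phi1, phi2, psi', psi2, h1; split=> //.
  rewrite -[eps phi1]eps_p -map_mxM -[_ *m _](subrK 1%:M).
  rewrite -[_ - 1%:M](subrK (K i *m h)) Dh1 !map_mxD !map_mxM !koszul_coeff0.
  by rewrite mulmx0 mul0mx !add0r map_scalar_mx rmorph1.
by rewrite -Dh1 opprB addrC subrK mulmxA koszul_complex mul0mx.
Qed.

(** Modulo the variables [phi] has a right inverse, so row [a] has an entry with nonzero constant
    term. Being homogeneous, this entry has degree 0, which forces the degrees of its row and column
    to agree. *)
Lemma koszul_degree i : (0 < koszul_rank m i)%N ->
  exists b : 'I_(mres_rank F i), mres_deg b = (i * t)%:Z.
Proof.
move=> rk_gt0; pose a := Ordinal rk_gt0.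
have [phi [_ [psi [_ [_ [hphi phipsi _ _ _]]]]]] := comparison_step i.
have [b phi_ab] : exists b, (phi a b)@_0%MM != 0.
  apply/existsP; apply: contra_eqT phipsi; rewrite negb_exists => /forallP phi0.
  apply/eqP=> /matrixP/(_ a a); rewrite !mxE eqxx big1 => [/eqP|b _].
    by rewrite eq_sym oner_eq0.
  by rewrite !mxE (eqP (negPn (phi0 b))) mul0r.
exists b; apply/esym/eqP; rewrite -subr_eq0; apply/eqP.
exact: homog_in_degree_coeff0 (hphi a b) phi_ab.
Qed.

End Comparison.

(** * Path ideals *)

Section PathIdeal.

Variables (k : fieldType) (n : nat) (le : rel 'I_n) (t : nat).
Local Notation S := {mpoly k[n]}.
Local Notation I := (path_ideal le t (k := k)).
Implicit Types (p : t.-tuple 'I_n) (g h : S).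

Definition path_mnm p : 'X_{1..n} := (\sum_(v <- p) U_(v))%MM.

Lemma path_monomialE p : path_monomial k p = 'X_[path_mnm p].
Proof. by rewrite /path_mnm (big_morph _ (@mpolyXD _ _) (mpolyX0 _ _)). Qed.

Lemma path_mnm_eq0 p v : v \notin p -> path_mnm p v = 0%N.
Proof.
move=> v_p; rewrite mnm_sumE big_seq big1 // => u u_p; rewrite mnm1E.
by case: eqP v_p => // <-; rewrite u_p.
Qed.

Lemma path_monomial_homog p : path_monomial k p \is t.-homog.
Proof.
rewrite path_monomialE dhomogX /= mdeg_sum (eq_bigr (fun=> 1%N)) => [|v _].
  by rewrite sum1_size size_tuple.
exact: mdeg1.
Qed.

Lemma path_monomial_ideal p : is_path le p -> I (path_monomial k p).
Proof.
move=> path_p; exists (fun q => (q == p)%:R).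
rewrite (bigD1 p) //= eqxx mul1r big1 ?addr0 // => q /andP[_ /negPf->].
by rewrite mul0r.
Qed.

Lemma path_ideal0 : I 0.
Proof. by exists (fun=> 0); rewrite big1 // => p _; rewrite mul0r. Qed.

Lemma path_idealD g h : I g -> I h -> I (g + h).
Proof.
move=> [c ->] [c' ->]; exists (fun p => c p + c' p).
by rewrite -big_split; apply: eq_bigr => p _; rewrite mulrDl.
Qed.

Lemma path_idealM g h : I h -> I (g * h).
Proof.
move=> [c ->]; exists (fun p => g * c p).
by rewrite mulr_sumr; apply: eq_bigr => p _; rewrite mulrA.
Qed.

Lemma path_ideal_homog z g : I g -> I (homog_part z g).
Proof.
move=> [c ->]; exists (fun p => homog_part (z - t%:Z) (c p)).
rewrite raddf_sum; apply: eq_bigr => p _; rewrite -{1}(subrK t%:Z z).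
exact/homog_partM/path_monomial_homog.
Qed.

Variable A : {set t.-tuple 'I_n}.
Hypothesis indA : induced_path_family le A.

Definition family_support : pred 'I_n := [pred v | [exists q in A, v \in q]].

Definition restrict : {rmorphism S -> S} :=
  comp_mpoly [tuple if family_support v then 'X_v else 0 | v < n].

Lemma restrictX v : restrict 'X_v = if family_support v then 'X_v else 0.
Proof. by rewrite /restrict /= comp_mpolyXU -tnth_nth tnth_mktuple. Qed.

(** Each variable goes to itself or to 0, so evaluation at the origin does not change. *)
Lemma restrict_coeff0 g : (restrict g)@_0%MM = g@_0%MM.
Proof.
elim/mpolyind: g => [|c m g _ _ IHg]; first by rewrite rmorph0.
rewrite rmorphD !mcoeffD IHg -mul_mpolyC rmorphM; congr (_ + _).
rewrite [RHS]rmorphM [LHS]rmorphM /= comp_mpolyC; congr (_ * _).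
rewrite mpolyXE_id !rmorph_prod; apply: eq_bigr => v _; rewrite !rmorphXn.
have Xv0 : ('X_v : S)@_0%MM = 0 by rewrite mcoeffX mnm1_eq0.
suff E : (restrict 'X_v)@_0%MM = ('X_v : S)@_0%MM by congr (_ ^+ _); exact: E.
by rewrite restrictX Xv0; case: ifP; rewrite ?mcoeff0.
Qed.

(** A path outside [A] has a vertex outside the support, since [A] is induced, and the variable of
    that vertex is killed. *)
Lemma restrict_path p :
  is_path le p ->
  restrict (path_monomial k p) = (p \in A)%:R * path_monomial k p.
Proof.
have /and3P[_ _ /forallP closedA] := indA.
move=> path_p; rewrite /path_monomial rmorph_prod.
have [p_A|p_A] := boolP (p \in A).
  rewrite mul1r; apply: eq_big_seq => v v_p; rewrite restrictX ifT //.
  by apply/existsP; exists p; rewrite p_A.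
have := closedA p; rewrite path_p (negPf p_A) implybF negb_forall /=.
case/existsP=> v; rewrite negb_imply => /andP[v_p v_A].
by rewrite mul0r (big_rem v) //= restrictX ifN ?mul0r.
Qed.

(** The comparison is applied in the top degree [#|A|] of the Koszul complex on the path monomials
    of [A], where the rank is positive. *)
Lemma induced_family_degree (F : minimal_resolution I) : (0 < t)%N ->
  exists b : 'I_(mres_rank F #|A|), mres_deg b = (#|A| * t)%:Z.
Proof.
move=> t_gt0.
(* The Koszul complex takes a sequence indexed by [nat]; the default is never reached for [j] below
   [#|A|]. *)
pose M j := nth 0%MM [seq path_mnm q | q <- enum A] j.
pose f j : S := 'X_[M j].
have Mq (i : 'I_#|A|) : M i = path_mnm (enum_val i).
  by rewrite /M (nth_map (enum_val i)) -?cardE // -enum_val_nth.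
have fq (i : 'I_#|A|) : f i = path_monomial k (enum_val i).
  by rewrite path_monomialE -Mq.
have /and3P[/forall_inP pathA /forall_inP disjA _] := indA.
have pathq (i : 'I_#|A|) : is_path le (enum_val i) by apply/pathA/enum_valP.
apply: (@koszul_degree _ _ _ F f #|A| t restrict) => //.
- exact: path_ideal0.
- exact: path_idealD.
- exact: path_idealM.
- exact: path_ideal_homog.
- by move=> j lt_j; rewrite (fq (Ordinal lt_j)) path_monomial_homog.
- by move=> j lt_j; rewrite (fq (Ordinal lt_j)); apply: path_monomial_ideal.
- apply: monomial_regular => i j v /andP[lt_ij lt_j].
  have lt_i := ltn_trans lt_ij lt_j.
  rewrite (Mq (Ordinal lt_i)) (Mq (Ordinal lt_j)).
  have neq_q : enum_val (Ordinal lt_i) != enum_val (Ordinal lt_j).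
    by rewrite (inj_eq enum_val_inj) -val_eqE neq_ltn lt_ij.
  have := disjA _ (enum_valP (Ordinal lt_i)).
  move=> /forall_inP/(_ _ (enum_valP (Ordinal lt_j))).
  rewrite neq_q => /forallP/(_ v); rewrite negb_and.
  by case/orP=> /path_mnm_eq0->; rewrite eqxx ?orbT.
- by move=> j lt_j; rewrite (fq (Ordinal lt_j)) restrict_path // enum_valP mul1r.
(* Restriction kills the terms of paths outside [A]; [e] lists the surviving coefficients in the
   order of [enum A]. *)
- move=> _ [c ->]; pose e j := nth 0 [seq restrict (c q) | q <- enum A] j.
  have eq_e (i : 'I_#|A|) : e i = restrict (c (enum_val i)).
    by rewrite /e (nth_map (enum_val i)) -?cardE // -enum_val_nth.
  exists e; rewrite rmorph_sum /=.
  transitivity (\sum_(q in A) restrict (c q) * path_monomial k q).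
    rewrite big_mkcond [RHS]big_mkcond; apply: eq_bigr => q _.
    case: ifPn => [path_q|]; last by case: ifP => // /pathA->.
    rewrite rmorphM restrict_path //=.
    by case: ifP => _; rewrite ?mul1r ?mul0r ?mulr0.
  by rewrite big_enum_val; apply: eq_bigr => i _; rewrite eq_e fq.
- exact: restrict_coeff0.
exact: koszul_rank_top.
Qed.

End PathIdeal.

(** * The regularity bound *)

Unset Implicit Arguments.

Theorem proposition3p1 (k : fieldType) (n : nat) (le : rel 'I_n)
  (le_refl : reflexive le) (le_anti : antisymmetric le)
  (le_trans : transitive le) (t : nat) (t_ge2 : (2 <= t)%N)
  (r : int) (reg_r : regularity (path_ideal le t (k := k)) r) :
  ((path_packing_number le t * (t - 1))%N)%:Z <= r.
Proof.
have t_gt0 : (0 < t)%N by apply: ltnW.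
have [F [_ maxF]] := reg_r.
have [|A indA maxA] := @eq_bigmax_cond _ [pred A | induced_path_family le A]
  (fun A : {set t.-tuple 'I_n} => #|A|).
  apply/card_gt0P; exists set0; rewrite inE; apply/and3P; split.
  - by apply/forall_inP=> q; rewrite inE.
  - by apply/forall_inP=> q; rewrite inE.
  (* A tuple of positive length has a first vertex, which the empty family cannot cover. *)
  apply/forallP=> q; apply/implyP=> /andP[_ /forall_inP].
  move/(_ (tnth q (Ordinal t_gt0))); rewrite mem_tnth.
  by case/(_ isT)/existsP=> q'; rewrite inE.
rewrite /path_packing_number [X in (X * _)%N]maxA.
have [b deg_b] := induced_family_degree indA F t_gt0.
(* The Betti number in step s and degree st, with s the size of [A], is nonzero, so st - s is at
   most [r]. *)
have := maxF #|A| (#|A| * t)%:Z; rewrite mulnBr muln1 subzn ?leq_pmulr //.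
apply; apply/eqP; rewrite -lt0n; apply/card_gt0P; exists b.
by rewrite inE deg_b.
Qed.
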